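(* If $A\le\mathcal{S}_m$ and $B\le\mathcal{S}_n$, then $$\delta_1(A\wr_I B)=\delta_1(A)\,\mathcal{P}_B'(\delta(A)),$$ where $\mathcal{P}_B'(x)=\sum_{\ell=1}^n\ell\,\delta_\ell(B)x^{\ell-1}$ is the derivative of $\mathcal{P}_B(x)=\sum_{\ell=0}^n\delta_\ell(B)x^\ell$.
   Context: $\mathcal{S}_n$ is the symmetric group on $[n]=\{1,\dots,n\}$; permutations act on the right, $x\mapsto xg$. For a finite group $G$ acting on a finite set, $\delta_k(G)$ is the proportion of elements of $G$ with exactly $k$ fixed points and $\delta(G)=\delta_0(G)$; subgroups of $\mathcal{S}_n$ act naturally on $[n]$. The wreath product $A\wr B=A^{[n]}\rtimes B$ has underlying set $A^{[n]}\times B$ ($A^{[n]}$ being the group of functions $[n]\to A$ under pointwise multiplication) and multiplication $(\alpha,b)(\beta,c)=(\alpha\beta^{b^{-1}},bc)$, where $\beta^{b}(y)=\beta(yb^{-1})$. $A\wr_I B$ denotes $A\wr B$ acting on $[m]\times[n]$ by $(x,y)(\alpha,b)=(x\alpha(y),yb)$. Convention: $x^0=1$, including $0^0=1$. *)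

(* Defs.v *)
From HB Require Import structures.
From mathcomp Require Import all_boot all_order all_algebra all_fingroup.

Set Implicit Arguments.
Unset Strict Implicit.
Unset Printing Implicit Defensive.

Import GroupScope GRing.Theory.

Definition delta (aT : finGroupType) (rT : finType) (to : {action aT &-> rT})
    (k : nat) (G : {set aT}) : rat :=
  (#|[set g in G | #|'Fix_to[g]| == k]|%:R / #|G|%:R)%R.

Definition fixpoly (n : nat) (B : {set 'S_n}) : {poly rat} :=
  (\sum_(0 <= l < n.+1) delta 'P l B *: 'X^l)%R.

(* A record rather than a pair, since the library equips the product of two
   groups with the direct product law. *)
Record wreath_type (gT : finGroupType) (n : nat) : predArgType := Wreath {
  wr_base : {ffun 'I_n -> gT};
  wr_top : 'S_n
}.

Section WreathGroup.

Variables (gT : finGroupType) (n : nat).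
Local Notation wT := (wreath_type gT n).
Implicit Types (u v w : wT) (f g : {ffun 'I_n -> gT}) (b c : 'S_n).

Definition wr_pair u := (wr_base u, wr_top u).
Definition wr_of_pair (p : {ffun 'I_n -> gT} * 'S_n) : wT := Wreath p.1 p.2.

Fact wr_pairK : cancel wr_pair wr_of_pair. Proof. by case. Qed.

HB.instance Definition _ := Finite.copy wT (can_type wr_pairK).

(* The function written f^b in the wreath product law. *)
Definition ffun_shift f b : {ffun 'I_n -> gT} := [ffun y => f (b^-1 y)].

Definition wr_mul u v : wT :=
  Wreath (wr_base u * ffun_shift (wr_base v) (wr_top u)^-1)
         (wr_top u * wr_top v).

Definition wr_one : wT := Wreath 1 1.

Definition wr_inv u : wT :=
  Wreath (ffun_shift (wr_base u)^-1 (wr_top u)) (wr_top u)^-1.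

Fact wr_mulA : associative wr_mul.
Proof.
move=> [f b] [g c] [h d]; congr Wreath; last exact: mulgA.
apply/ffunP=> y; rewrite /ffun_shift /=.
by do !rewrite !ffunE /=; rewrite !invgK permM mulgA.
Qed.

Fact wr_mul1 : left_id wr_one wr_mul.
Proof.
move=> [f b]; congr Wreath; last exact: mul1g.
apply/ffunP=> y; rewrite /ffun_shift /=.
by do !rewrite !ffunE /=; rewrite invgK perm1 mul1g.
Qed.

Fact wr_mulV : left_inverse wr_one wr_inv wr_mul.
Proof.
move=> [f b]; congr Wreath; last exact: mulVg.
apply/ffunP=> y; rewrite /ffun_shift /=.
by do !rewrite !ffunE /=; rewrite invgK mulVg.
Qed.

HB.instance Definition _ :=
  Finite_isGroup.Build wT wr_mulA wr_mul1 wr_mulV.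

Definition wreath (A : {set gT}) (B : {set 'S_n}) : {set wT} :=
  [set u : wT | [forall y, wr_base u y \in A] && (wr_top u \in B)].

Fact wreath_group_set (A : {group gT}) (B : {group 'S_n}) :
  group_set (wreath A B).
Proof.
apply/group_setP; split=> [|[f b] [g c]].
  by rewrite inE /= group1 andbT; apply/forallP=> y; rewrite ffunE group1.
rewrite !inE /= => /andP[/forallP Af Bb] /andP[/forallP Ag Bc].
rewrite groupM // andbT; apply/forallP=> y.
by rewrite /ffun_shift /=; do !rewrite !ffunE /=; rewrite groupM.
Qed.

Canonical wreath_group (A : {group gT}) (B : {group 'S_n}) :=
  Group (wreath_group_set A B).

End WreathGroup.

Section ImprimitiveAction.

Variables m n : nat.

Definition wr_imprim (p : 'I_m * 'I_n) (u : wreath_type 'S_m n) :=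
  (wr_base u p.2 p.1, wr_top u p.2).

Fact wr_imprim1 : wr_imprim^~ 1 =1 id.
Proof. by case=> x y; rewrite /wr_imprim /= ffunE !perm1. Qed.

Fact wr_imprimM p : act_morph wr_imprim p.
Proof.
case: p => x y [f b] [g c]; rewrite /wr_imprim /=; congr pair.
  by rewrite /ffun_shift /=; do !rewrite !ffunE /=; rewrite invgK permM.
by rewrite permM.
Qed.

Definition imprim_action : {action wreath_type 'S_m n &-> 'I_m * 'I_n} :=
  TotalAction wr_imprim1 wr_imprimM.

End ImprimitiveAction.

(* Main.v *)
(** An element (f, b) fixes (x, y) iff b fixes y and f(y) fixes x, so its number
    of fixed points is the sum of fix(f(y)) over y in Fix(b).  This sum is 1 iff
    one f(y0) with y0 in Fix(b) has a single fixed point and the other f(y) with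
    y in Fix(b) are derangements, which for given b with l fixed points happens
    for a proportion l * delta_1(A) * delta_0(A)^(l-1) of the f. *)

Require Import Defs.
From mathcomp Require Import all_boot all_order all_algebra all_fingroup.
From mathcomp Require Import ring.

Import GroupScope GRing.Theory.

Lemma sum_nat_eq1_delta (I : finType) (S : {set I}) (F : I -> nat) :
  (\sum_(x in S) F x == 1)%N
    = [exists y in S, [forall x in S, F x == (x == y)]].
Proof.
apply/sum_nat_eq1/exists_inP => [[y [Sy Fy F0]]|[y Sy /forall_inP Fd]].
  exists y => //; apply/forall_inP => x Sx.
  by have [->|/F0->] := eqVneq x y; rewrite ?Fy.
exists y; split=> // [|x neq_xy Sx]; first by rewrite (eqP (Fd y Sy)) eqxx.
by rewrite (eqP (Fd x Sx)) (negPf neq_xy).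
Qed.

Lemma card_ffun_family (I T : finType) (F : I -> {set T}) :
  #|[set f : {ffun I -> T} | [forall x, f x \in F x]]| = (\prod_x #|F x|)%N.
Proof.
rewrite -[RHS](big_image _ _ (fun x => #|F x|) I id) -foldrE.
rewrite -card_family cardsE.
by apply: eq_card => f; rewrite !inE.
Qed.

Lemma card_ffun_sum_eq1 (I T : finType) (S : {set I}) (A : {set T})
    (phi : T -> nat) :
  #|[set f : {ffun I -> T} |
       [forall x, f x \in A] && (\sum_(x in S) phi (f x) == 1)%N]|
  = (#|S| * (#|[set a in A | phi a == 1%N]|
             * #|[set a in A | phi a == 0%N]| ^ #|S|.-1 * #|A| ^ #|~: S|))%N.
Proof.
pose F y x : {set T} := [set a in A | (x \in S) ==> (phi a == (x == y))].
pose fam y :=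
  [set f : {ffun I -> T} | (y \in S) && [forall x, f x \in F y x]].
have famP y (f : {ffun I -> T}) : reflect
    [/\ y \in S, forall x, f x \in A
       & forall x, x \in S -> phi (f x) = (x == y)] (f \in fam y).
  rewrite inE; apply: (iffP andP) => [[Sy /forallP Ff]|[Sy Af Pf]].
    split=> // x => [|Sx]; first by have:= Ff x; rewrite inE => /andP[].
    by have:= Ff x; rewrite inE Sx => /andP[_ /eqP].
  split=> //; apply/forallP=> x.
  by rewrite inE Af; apply/implyP=> Sx; rewrite Pf.
have ->: [set f : {ffun I -> T} |
       [forall x, f x \in A] && (\sum_(x in S) phi (f x) == 1)%N]
    = \bigcup_y fam y.
  apply/setP=> f; rewrite inE sum_nat_eq1_delta.
  apply/andP/bigcupP => [[/forallP Af /exists_inP[y Sy /forall_inP Pf]]|].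
    by exists y => //; apply/famP; split=> // x Sx; apply/eqP/Pf.
  case=> y _ /famP[Sy Af Pf]; split; first exact/forallP.
  by apply/exists_inP; exists y => //; apply/forall_inP=> x Sx; apply/eqP/Pf.
have tI y z : y != z -> [disjoint fam y & fam z].
  move=> neq_yz; apply/pred0P=> f /=; apply/andP=> -[].
  move=> /famP[Sy _ Pf] /famP[_ _ /(_ y Sy)].
  by rewrite Pf // eqxx (negPf neq_yz).
rewrite -sum1_card partition_disjoint_bigcup //= -sum_nat_const.
rewrite [RHS]big_mkcond; apply: eq_bigr => y _; rewrite sum1_card.
have [Sy|nSy] := ifPn; last first.
  by apply/eq_card0=> f; rewrite inE (negPf nSy).
rewrite /fam; under eq_finset do rewrite Sy.
rewrite card_ffun_family (bigID (mem S)) /= (bigD1 y) //=.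
congr (_ * _ * _)%N.
- by apply: eq_card => a; rewrite !inE Sy eqxx.
- rewrite (eq_bigr (fun=> #|[set a in A | phi a == 0%N]|)).
    rewrite prod_nat_const (cardsD1 y S) Sy; congr (_ ^ _)%N.
    by apply: eq_card => x; rewrite !inE andbC.
  move=> x /andP[Sx neq_xy].
  by apply: eq_card => a; rewrite !inE Sx (negPf neq_xy).
rewrite (eq_bigr (fun=> #|A|)) => [|x /negPf nSx].
  by rewrite prod_nat_const; congr (_ ^ _)%N; apply: eq_card => x; rewrite !inE.
by apply: eq_card => a; rewrite !inE nSx andbT.
Qed.

Lemma card_Fix_imprim (m n : nat) (u : wreath_type 'S_m n) :
  #|'Fix_(imprim_action m n)([set u])|
    = (\sum_(y in 'Fix_'P[wr_top u]) #|'Fix_'P[wr_base u y]|)%N.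
Proof.
under eq_bigr => y _ do rewrite -sum1_card.
rewrite (exchange_big_dep predT) //= pair_big_dep -sum1_card /=.
apply: eq_bigl => -[x y]; rewrite !inE !sub1set !inE /= /aperm xpair_eqE.
by rewrite andbC.
Qed.

Lemma card_wreath_dep (gT : finGroupType) (n : nat)
    (P : {ffun 'I_n -> gT} -> 'S_n -> bool) :
  #|[set u : wreath_type gT n | P (wr_base u) (wr_top u)]|
    = (\sum_b #|[set f | P f b]|)%N.
Proof.
under eq_bigr do rewrite -sum1dep_card.
rewrite (exchange_big_dep predT) //= pair_big_dep -sum1dep_card /=.
by rewrite (reindex (@wr_of_pair gT n)) //; exists (@wr_pair gT n) => -[].
Qed.

Lemma card_wreath (gT : finGroupType) (n : nat) (A : {set gT})
    (B : {set 'S_n}) :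
  #|wreath A B| = (#|A| ^ n * #|B|)%N.
Proof.
rewrite (card_wreath_dep _ _ (fun f b => [forall y, f y \in A] && (b \in B))).
rewrite mulnC -sum_nat_const [RHS]big_mkcond; apply: eq_bigr => b _ /=.
have [Bb|nBb] := boolP (b \in B); last first.
  by apply/eq_card0=> f; rewrite inE andbF.
under eq_finset do rewrite andbT.
by rewrite card_ffun_family prod_nat_const card_ord.
Qed.

Local Open Scope ring_scope.

Lemma sum_by_card_Fix (n : nat) (B : {set 'S_n}) (F : nat -> rat) :
  (\sum_(b in B) F #|'Fix_'P[b]|) / #|B|%:R
    = \sum_(0 <= l < n.+1) delta 'P l B * F l.
Proof.
have lt_fix (b : 'S_n) : (#|'Fix_'P[b]| < n.+1)%N.
  by rewrite ltnS -[leqRHS]card_ord max_card.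
rewrite (partition_big (fun b => Ordinal (lt_fix b)) predT) //= mulr_suml.
rewrite big_mkord; apply: eq_bigr => l _.
rewrite (eq_bigr (fun=> F l)) => [|b /andP[_ /eqP<-] //].
rewrite sumr_const -[_ *+ #|_|]mulr_natl mulrAC /delta; congr (_%:R / _ * _).
by apply: eq_card => b; rewrite !inE.
Qed.

Lemma deriv_fixpoly (n : nat) (B : {set 'S_n}) :
  (fixpoly B)^`() =
    \sum_(1 <= l < n.+1) (l%:R * delta 'P l B) *: 'X^(l.-1).
Proof.
rewrite /fixpoly big_nat_recl // big_add1 /= derivD derivZ derivXn.
rewrite scaler0 add0r raddf_sum; apply: eq_bigr => l _.
by rewrite /= derivZ derivXn /= -scaler_nat scalerA mulrC.
Qed.

Theorem corollary5p2 (m n : nat) (A : {group 'S_m}) (B : {group 'S_n}) :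
  (fixpoly B)^`() =
    \sum_(1 <= l < n.+1) (l%:R * delta 'P l B) *: 'X^(l.-1)
  /\ delta (imprim_action m n) 1 (wreath A B) =
       delta 'P 1 A * (fixpoly B)^`().[delta 'P 0 A].
Proof.
split; first exact: deriv_fixpoly.
pose a k := #|[set g in A | #|'Fix_'P[g]| == k]|.
pose F l : rat := l%:R * (delta 'P 1 A * delta 'P 0 A ^+ l.-1).
have A0 : #|A|%:R != 0 :> rat by rewrite Num.Theory.pnatr_eq0 -lt0n cardG_gt0.
transitivity ((\sum_(b in B) F #|'Fix_'P[b]|) / #|B|%:R); last first.
  rewrite sum_by_card_Fix deriv_fixpoly horner_sum mulr_sumr.
  rewrite big_nat_recl // big_add1 /= /F mul0r mulr0 add0r.
  by apply: eq_bigr => l _; rewrite hornerZ hornerXn /=; ring.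
rewrite /delta card_wreath natrM invfM mulrA; congr (_ / _).
have -> : #|[set u in wreath A B | #|'Fix_(imprim_action m n)([set u])| == 1%N]|
    = (\sum_(b in B) #|'Fix_'P[b]| *
        (a 1 * a 0 ^ #|'Fix_'P[b]|.-1 * #|A| ^ #|~: 'Fix_'P[b]|))%N.
  pose P (f : {ffun 'I_n -> 'S_m}) b := (b \in B) && ([forall y, f y \in A] &&
    (\sum_(y in 'Fix_'P[b]) #|'Fix_'P[f y]| == 1)%N).
  transitivity #|[set u : wreath_type 'S_m n | P (wr_base u) (wr_top u)]|.
    apply: eq_card => u; rewrite !inE card_Fix_imprim /P.
    by case: (_ \in B); rewrite ?andbT ?andbF.
  rewrite card_wreath_dep [RHS]big_mkcond; apply: eq_bigr => b _ /=.
  rewrite /P; have [Bb|nBb] := boolP (b \in B); last first.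
    by apply/eq_card0=> f; rewrite inE.
  exact: (card_ffun_sum_eq1 _ _ _ A (fun g : 'S_m => #|'Fix_'P[g]|)).
rewrite natr_sum mulr_suml; apply: eq_bigr => b Bb.
rewrite /F /delta -/(a 1%N) -/(a 0%N).
have [->|] := posnP #|'Fix_'P[b]|; first by rewrite !mul0r.
have := cardsC 'Fix_'P[b]; rewrite card_ord.
set s := #|'Fix_'P[b]|; set t := #|~: _| => <-.
case: s => // s _; rewrite !natrM !natrX /= exprMn exprVn exprD exprS.
by rewrite mulf_div !mulrA -[LHS]mulf_div divff ?expf_neq0 // mulr1.
Qed.
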